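(* Let $L$ be the Lagrangian of a Chaplygin system on $Q$ with symmetry group $G$, constraint distribution $\mathcal D$ and constraint submanifold $\mathcal C\subset TQ$, and suppose that $L$ is regular with respect to $\mathcal D$ and to $\mathfrak g$. Let $\tilde\Gamma^0$ be the restriction to $\mathcal C$ of the Euler-Lagrange field $\tilde\Gamma$ of $\tilde L=L-p_av^a$, and let $\Gamma$ be the nonholonomic dynamical field of the system. Then $\tilde\Gamma^0$ equals $\Gamma$ if and only if $$R^a_{\alpha\beta}v^\beta p_a=0\quad\text{on }\mathcal C\qquad(\alpha=1,\dots,m),$$ or, equivalently, if and only if the conditions for weak (and thus strong) consistency of the nonholonomic and vakonomic problems are satisfied with the section $\phi_a=p_a|_{\mathcal C}$.
   Context: Considerations are local (over the domain of the frame below). Summation convention. $\tau:TQ\to Q$; local coordinates $q^i$ on $Q$, fibre coordinates $u^i$ on $TQ$. For a vector field $Z=Z^i\,\partial/\partial q^i$ on $Q$: complete lift $Z^{\mathrm C}=Z^i\frac{\partial}{\partial q^i}+u^j\frac{\partial Z^i}{\partial q^j}\frac{\partial}{\partial u^i}$, vertical lift $Z^{\mathrm V}=Z^i\frac{\partial}{\partial u^i}$. Chaplygin system: a Lie group $G$ (with Lie algebra $\mathfrak g$) acts freely and properly on the $n$-dimensional manifold $Q$, so $Q\to Q/G$ is a principal bundle; $L$ is a smooth function on $TQ$ invariant under the induced action of $G$ on $TQ$; and the (non-integrable, rank $m$) constraint distribution $\mathcal D$ is the horizontal distribution of a principal connection on $Q\to Q/G$. $\mathcal C=\{(q,u)\in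 TQ:u\in\mathcal D_q\}$. Frame: $\{X_i\}=\{X_\alpha,X_a=\tilde E_a\}$, $\alpha=1,\dots,m$, $a=m+1,\dots,n$, where the $\tilde E_a$ are the fundamental vector fields of the action corresponding to a basis of $\mathfrak g$, so that $[\tilde E_a,\tilde E_b]=-C_{ab}^c\tilde E_c$ with $C^c_{ab}$ the structure constants, and the $X_\alpha$ are $G$-invariant vector fields spanning $\mathcal D$, so $[\tilde E_a,X_\alpha]=0$. The functions $R^k_{ij}$ are defined by $[X_i,X_j]=R^k_{ij}X_k$ (in particular $R^i_{a\alpha}=0$). With dual coframe $\{\theta^i\}$, the quasi-velocities are $v^i(q,u)=\theta^i_q(u)$; $\mathcal C$ is given by $v^a=0$. Momentum components: $p_a=\tilde E_a^{\mathrm V}(L)$, functions on $TQ$. With $g_{ij}=X_i^{\mathrm V}(X_j^{\mathrm V}(L))$: $L$ is regular with respect to $\mathcal D$ if $(g_{\alpha\beta})$ is nonsingular on $\mathcal C$, and regular with respect to $\mathfrak g$ if the submatrix $(g_{ab})=(\tilde E_a^{\mathrm V}(\tilde E_b^{\mathrm V}(L)))$ is nonsingular. Under these assumptions $\tilde L$ has nonsingular velocity Hessian in a neighbourhood of $\mathcal C$; its Euler-Lagrange field there is the unique second-order differential equation field $\tilde\Gamma$ ($\tau_{*(q,u)}\tilde\Gamma=u$) with $\tilde\Gamma(X_i^{\mathrm V}(\tilde L))-X_i^{\mathrm C}(\tilde L)=0$ for $i=1,\dots,n$; it is tangent to $\mathcal C$. The nonholonomic field $\Gamma$ is the unique vector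 field on $\mathcal C$ which is of second-order type ($\tau_{*(q,u)}\Gamma=u$ on $\mathcal C$), tangent to $\mathcal C$, and satisfies $\Gamma(X_\alpha^{\mathrm V}(L))-X_\alpha^{\mathrm C}(L)=0$ on $\mathcal C$ for $\alpha=1,\dots,m$. Its multipliers are $\lambda_a=\Gamma(\tilde E_a^{\mathrm V}(L))-\tilde E_a^{\mathrm C}(L)$ on $\mathcal C$. For functions $\phi_a$ on $\mathcal C$ (a section $\mu_a=\phi_a$ of $\mathcal C\times\mathbb R^{n-m}\to\mathcal C$), the condition for weak consistency of the nonholonomic and vakonomic problems with this section is $\phi_aR^a_{\alpha\beta}v^\beta=0$ on $\mathcal C$ for all $\alpha$; the conditions for strong consistency with this section are this together with $\Gamma(\phi_a)+\phi_bR^b_{a\alpha}v^\alpha=\lambda_a$ on $\mathcal C$ for all $a$. *)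

(* Defs.v *)
From HB Require Import structures.
From mathcomp Require Import all_boot all_order all_algebra.
From mathcomp Require Import all_classical all_reals all_analysis.

Set Implicit Arguments.
Unset Strict Implicit.
Unset Printing Implicit Defensive.

Import Order.TTheory GRing.Theory Num.Theory.
Import numFieldNormedType.Exports.

Local Open Scope classical_set_scope.
Local Open Scope ring_scope.

(** * Smooth manifolds, in charts *)

(* On an open subset of a finite-dimensional space, where it is used below,
   asking that all the directional derivatives be C^r amounts to asking that
   the differential be C^r. *)
Fixpoint Ck (R : realType) (V W : normedModType R) (r : nat)
    (A : set V) (f : V -> W) : Prop :=
  match r with
  | 0%N => forall x, A x -> {for x, continuous f}
  | r'.+1 => (forall x, A x -> differentiable f x) /\
             (forall v : V, Ck r' A (fun x => 'D_v f x))
  end.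

Definition smooth_on (R : realType) (V W : normedModType R)
    (A : set V) (f : V -> W) : Prop :=
  forall r : nat, Ck r A f.

(* Smoothness on a subset A that need not be open: local smooth extendability. *)
Definition smooth_along (R : realType) (V W : normedModType R)
    (A : set V) (f : V -> W) : Prop :=
  forall x, A x -> exists (O : set V) (g : V -> W),
    [/\ open O, O x, smooth_on O g & forall y, A y -> O y -> g y = f y].

Record chart (R : realType) (T : topologicalType) (n : nat) := Chart {
  cdom : set T;
  ccod : set 'rV[R]_n;
  cmap : T -> 'rV[R]_n;
  cinv : 'rV[R]_n -> T;
  cdom_open : open cdom;
  ccod_open : open ccod;
  cmapP : forall q, cdom q -> ccod (cmap q);
  cinvP : forall x, ccod x -> cdom (cinv x);
  cmapK : forall q, cdom q -> cinv (cmap q) = q;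
  cinvK : forall x, ccod x -> cmap (cinv x) = x;
  cmap_cont : forall q, cdom q -> {for q, continuous cmap};
  cinv_cont : forall x, ccod x -> {for x, continuous cinv}
}.

Record manifold (R : realType) (n : nat) := Manifold {
  mpoints :> topologicalType;
  mpoints_hausdorff : hausdorff_space mpoints;
  mpoints_second_countable : @second_countable mpoints;
  atlas : set (chart R mpoints n);
  atlas_cover : forall q, exists2 c, atlas c & cdom c q;
  atlas_compat : forall c d, atlas c -> atlas d ->
    smooth_on [set x | ccod c x /\ cdom d (cinv c x)] (cmap d \o cinv c)
}.

Arguments atlas {R n} m.

Section Maps.
Variables (R : realType) (m n p : nat).
Variables (M : manifold R m) (N : manifold R n) (P : manifold R p).

Definition coord (c : chart R M m) (d : chart R N n) (F : M -> N)
  : 'rV[R]_m -> 'rV[R]_n := cmap d \o F \o cinv c.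

Definition coord_dom (c : chart R M m) (d : chart R N n) (F : M -> N)
  : set 'rV[R]_m := [set x | ccod c x /\ cdom d (F (cinv c x))].

(* The tangent map TF, in the coordinates (position, velocity) of the charts
   of TM and TN induced by c and d. *)
Definition tcoord (c : chart R M m) (d : chart R N n) (F : M -> N)
    (z : 'rV[R]_m * 'rV[R]_m) : 'rV[R]_n * 'rV[R]_n :=
  (coord c d F z.1, 'D_(z.2) (coord c d F) z.1).

Definition smooth_map (F : M -> N) : Prop :=
  continuous F /\
  forall c d, atlas M c -> atlas N d ->
    smooth_on (coord_dom c d F) (coord c d F).

(* Smoothness of a map M x N -> P, with respect to the product charts. *)
Definition smooth_map2 (F : M -> N -> P) : Prop :=
  continuous (fun z : M * N => F z.1 z.2) /\
  forall c d e, atlas M c -> atlas N d -> atlas P e ->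
    smooth_on
      [set z : 'rV[R]_m * 'rV[R]_n |
        [/\ ccod c z.1, ccod d z.2 & cdom e (F (cinv c z.1) (cinv d z.2))]]
      (fun z : 'rV[R]_m * 'rV[R]_n => cmap e (F (cinv c z.1) (cinv d z.2))).

End Maps.

Record lie_group (R : realType) (k : nat) := LieGroup {
  lg_manifold :> manifold R k;
  lg_mul : lg_manifold -> lg_manifold -> lg_manifold;
  lg_one : lg_manifold;
  lg_inv : lg_manifold -> lg_manifold;
  lg_mulA : associative lg_mul;
  lg_mul1 : left_id lg_one lg_mul;
  lg_mulV : left_inverse lg_one lg_inv lg_mul;
  lg_mul_smooth : smooth_map2 lg_mul;
  lg_inv_smooth : smooth_map lg_inv
}.
Arguments lg_one {R k} l.

(** * Local calculus on the tangent bundle *)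

(* Fields on (an open part of) Q are maps x |-> Z x in coordinates q^i; points
   of TQ are pairs (q, u), and fields on TQ are maps into pairs
   (d/dq-components, d/du-components). *)
Section LocalCalculus.
Variables (R : realType) (n : nat).
Local Notation E := 'rV[R]_n.
Implicit Types (Y Z : E -> E) (f : E * E -> R) (A : E * E -> E * E).

Definition bracket Y Z : E -> E :=
  fun x => 'D_(Y x) Z x - 'D_(Z x) Y x.

Definition complete_lift Z : E * E -> E * E :=
  fun z => (Z z.1, 'D_(z.2) Z z.1).

Definition vertical_lift Z : E * E -> E * E :=
  fun z => (0, Z z.1).

Definition apply_field A f : E * E -> R := fun z => 'D_(A z) f z.

Definition second_order (S : set (E * E)) A : Prop :=
  forall z, S z -> (A z).1 = z.2.

End LocalCalculus.

(** * Functions on TM and distributions on M *)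

Section TangentObjects.
Variables (R : realType) (n : nat) (M : manifold R n).
Local Notation E := 'rV[R]_n.

(* A smooth function on TM, given by its expressions in the induced charts. *)
Record tfun := TFun {
  tfun_rep :> chart R M n -> E * E -> R;
  tfun_compat : forall c d z, atlas M c -> atlas M d ->
    coord_dom c d id z.1 -> tfun_rep d (tcoord c d id z) = tfun_rep c z;
  tfun_smooth : forall c, atlas M c ->
    smooth_on [set z | ccod c z.1] (tfun_rep c)
}.

(* A smooth distribution of rank r, given by its expressions in charts. *)
Record distribution (r : nat) := Distribution {
  distr_rep :> chart R M n -> E -> {vspace E};
  distr_compat : forall c d x w, atlas M c -> atlas M d ->
    coord_dom c d id x -> w \in distr_rep c x ->
    'D_w (coord c d id) x \in distr_rep d (coord c d id x);
  distr_rank : forall c x, atlas M c -> ccod c x -> \dim (distr_rep c x) = r;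
  distr_smooth : forall c x, atlas M c -> ccod c x ->
    exists (O : set E) (Y : 'I_r -> E -> E),
      [/\ open O, O x, O `<=` ccod c, (forall i, smooth_on O (Y i)) &
          forall y, O y -> distr_rep c y = <<[seq Y i y | i : 'I_r]>>%VS]
}.

(* Integrability of D, through the Frobenius theorem. *)
Definition involutive_distribution (r : nat) (D : distribution r) : Prop :=
  forall (c : chart R M n) (O : set E) (Y Z : E -> E),
    atlas M c -> open O -> O `<=` ccod c ->
    smooth_on O Y -> smooth_on O Z ->
    (forall x, O x -> Y x \in D c x) -> (forall x, O x -> Z x \in D c x) ->
    forall x, O x -> bracket Y Z x \in D c x.

End TangentObjects.

(** * Chaplygin systems *)

Section Action.
Variables (R : realType) (n k : nat) (G : lie_group R k) (Q : manifold R n).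

Record free_proper_action := FreeProperAction {
  act :> G -> Q -> Q;
  act1 : forall q, act (lg_one G) q = q;
  actM : forall g h q, act (lg_mul g h) q = act g (act h q);
  act_smooth : smooth_map2 act;
  act_free : forall g q, act g q = q -> g = lg_one G;
  act_proper : forall K : set (Q * Q), compact K ->
    compact [set z : G * Q | K (act z.1 z.2, z.2)]
}.

Variable phi : free_proper_action.

(* The fundamental vector field of the Lie algebra element with components xi
   in the chart b around the identity: its value at q is the image of xi under
   the tangent map at the identity of g |-> g q, i.e. d/dt exp(t xi) q at 0. *)
Definition fundamental (b : chart R G k) (c : chart R Q n)
    (xi : 'rV[R]_k) (x : 'rV[R]_n) : 'rV[R]_n :=
  'D_xi (fun y => cmap c (phi (cinv b y) (cinv c x))) (cmap b (lg_one G)).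

Definition vertical (b : chart R G k) (c : chart R Q n) (x : 'rV[R]_n)
  : {vspace 'rV[R]_n} :=
  <<[seq fundamental b c (delta_mx 0%R a) x | a : 'I_k]>>%VS.

(* D is the horizontal distribution of a principal connection. *)
Definition horizontal (r : nat) (D : distribution Q r) : Prop :=
  (forall b c x, atlas G b -> cdom b (lg_one G) -> atlas Q c -> ccod c x ->
     (vertical b c x + D c x)%VS = fullv /\
     (vertical b c x :&: D c x)%VS = 0%VS) /\
  (forall g c d x w, atlas Q c -> atlas Q d -> coord_dom c d (phi g) x ->
     w \in D c x ->
     'D_w (coord c d (phi g)) x \in D d (coord c d (phi g) x)).

Definition invariant_tfun (L : tfun Q) : Prop :=
  forall g c d z, atlas Q c -> atlas Q d -> coord_dom c d (phi g) z.1 ->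
    L d (tcoord c d (phi g) z) = L c z.

End Action.

Record chaplygin (R : realType) (m k : nat)
    (G : lie_group R k) (Q : manifold R (m + k)) := Chaplygin {
  chap_act : free_proper_action G Q;
  chap_D : distribution Q m;
  chap_D_horizontal : horizontal chap_act chap_D;
  chap_D_nonintegrable : ~ involutive_distribution chap_D;
  chap_L : tfun Q;
  chap_L_invariant : invariant_tfun chap_act chap_L
}.

(** * The adapted frame and the objects it defines *)

Section Frame.
Variables (R : realType) (m k : nat) (G : lie_group R k)
  (Q : manifold R (m + k)) (S : chaplygin G Q).
Local Notation n := (m + k)%N.
Local Notation E := 'rV[R]_n.

(* The frame X_i, i : 'I_(m + k): the indices lshift k alpha are those of the
   X_alpha and the indices rshift m a those of the fundamental fields. *)
Definition frame_field (b : chart R G k) (c : chart R Q n)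
    (xi : 'I_k -> 'rV[R]_k) (Xh : 'I_m -> E -> E) (i : 'I_n) : E -> E :=
  match fintype.split i with
  | inl alpha => Xh alpha
  | inr a => fundamental (chap_act S) b c (xi a)
  end.

(* The domain fr_dom of the frame is (the image of) an open subset of the
   domain of a coordinate chart fr_chart; the Lie algebra is identified with
   R^k by the chart fr_gchart around the identity. *)
Record adapted_frame := AdaptedFrame {
  fr_chart : chart R Q n;
  fr_chart_atlas : atlas Q fr_chart;
  fr_dom : set E;
  fr_dom_open : open fr_dom;
  fr_dom_sub : fr_dom `<=` ccod fr_chart;
  fr_gchart : chart R G k;
  fr_gchart_atlas : atlas G fr_gchart;
  fr_gchart_one : cdom fr_gchart (lg_one G);
  fr_basis : 'I_k -> 'rV[R]_k;
  fr_basisP : \matrix_(a < k) fr_basis a \in unitmx;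
  fr_hor : 'I_m -> E -> E;
  fr_hor_smooth : forall alpha, smooth_on fr_dom (fr_hor alpha);
  fr_hor_span : forall x, fr_dom x ->
    <<[seq fr_hor alpha x | alpha : 'I_m]>>%VS = chap_D S fr_chart x;
  fr_hor_invariant : forall alpha g x,
    let F := coord fr_chart fr_chart (chap_act S g) in
    fr_dom x -> coord_dom fr_chart fr_chart (chap_act S g) x ->
    fr_dom (F x) -> fr_hor alpha (F x) = 'D_(fr_hor alpha x) F x;
  fr_frameP : forall x, fr_dom x ->
    \matrix_(i < n) frame_field fr_gchart fr_chart fr_basis fr_hor i x
      \in unitmx
}.

Variable F : adapted_frame.

Definition frm (i : 'I_n) : E -> E :=
  frame_field (fr_gchart F) (fr_chart F) (fr_basis F) (fr_hor F) i.
Definition frm_h (alpha : 'I_m) : E -> E := frm (lshift k alpha).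
Definition frm_v (a : 'I_k) : E -> E := frm (rshift m a).

(* The components with respect to X_1, ..., X_n of a tangent vector at x. *)
Definition components (x w : E) : E :=
  w *m invmx (\matrix_(i < n) frm i x).

(* [X_i, X_j] = Rf i j l * X_l *)
Definition Rf (i j l : 'I_n) (x : E) : R :=
  components x (bracket (frm i) (frm j) x) 0 l.

Definition qv (i : 'I_n) (z : E * E) : R := components z.1 z.2 0 i.
Definition qvh (alpha : 'I_m) : E * E -> R := qv (lshift k alpha).
Definition qvv (a : 'I_k) : E * E -> R := qv (rshift m a).

Definition lagr : E * E -> R := chap_L S (fr_chart F).

Definition tangent_dom : set (E * E) := [set z | fr_dom F z.1].
Definition constr : set (E * E) :=
  [set z | fr_dom F z.1 /\ z.2 \in chap_D S (fr_chart F) z.1].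

Definition Vl (Z : E -> E) (f : E * E -> R) : E * E -> R :=
  apply_field (vertical_lift Z) f.
Definition Cl (Z : E -> E) (f : E * E -> R) : E * E -> R :=
  apply_field (complete_lift Z) f.

Definition momentum (a : 'I_k) : E * E -> R := Vl (frm_v a) lagr.

Definition hess (i j : 'I_n) : E * E -> R := Vl (frm i) (Vl (frm j) lagr).

Definition regular_D : Prop :=
  forall z, constr z ->
    \matrix_(alpha < m, beta < m) hess (lshift k alpha) (lshift k beta) z
      \in unitmx.

Definition regular_g : Prop :=
  forall z, tangent_dom z ->
    \matrix_(a < k, b < k) hess (rshift m a) (rshift m b) z \in unitmx.

Definition Ltilde : E * E -> R :=
  fun z => lagr z - \sum_(a < k) momentum a z * qvv a z.

(* A is the Euler-Lagrange field of the Lagrangian f on the open set N. *)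
Definition euler_lagrange_field (f : E * E -> R) (N : set (E * E))
    (A : E * E -> E * E) : Prop :=
  [/\ smooth_on N A, second_order N A &
      forall (i : 'I_n) z, N z ->
        apply_field A (Vl (frm i) f) z - Cl (frm i) f z = 0].

(* Only the values of A on constr matter. *)
Definition nonholonomic_field (A : E * E -> E * E) : Prop :=
  [/\ smooth_along constr A,
      second_order constr A,
      (* tangency to constr, which is the zero set of the v^a *)
      forall (a : 'I_k) z, constr z -> apply_field A (qvv a) z = 0 &
      forall (alpha : 'I_m) z, constr z ->
        apply_field A (Vl (frm_h alpha) lagr) z - Cl (frm_h alpha) lagr z = 0].

Definition multiplier (A : E * E -> E * E) (a : 'I_k) : E * E -> R :=
  fun z => apply_field A (Vl (frm_v a) lagr) z - Cl (frm_v a) lagr z.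

(* Functions on constr are given by (any) extension to TQ; as the nonholonomic field
   is tangent to constr, its action on them does not depend on the extension. *)
Definition weakly_consistent (phi : 'I_k -> E * E -> R) : Prop :=
  forall (alpha : 'I_m) z, constr z ->
    \sum_(a < k) \sum_(beta < m)
      phi a z * Rf (lshift k alpha) (lshift k beta) (rshift m a) z.1
              * qvh beta z = 0.

Definition strongly_consistent (A : E * E -> E * E)
    (phi : 'I_k -> E * E -> R) : Prop :=
  weakly_consistent phi /\
  forall (a : 'I_k) z, constr z ->
    apply_field A (phi a) z
    + \sum_(b < k) \sum_(alpha < m)
        phi b z * Rf (rshift m a) (lshift k alpha) (rshift m b) z.1
                * qvh alpha z
    = multiplier A a z.

End Frame.

(* Main.v *)
Require Import Defs.
From HB Require Import structures.
From mathcomp Require Import all_boot all_order all_algebra.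
From mathcomp Require Import all_classical all_reals all_analysis.
From mathcomp Require Import ring.

Import Order.TTheory GRing.Theory Num.Theory.
Import numFieldNormedType.Exports.

Set Implicit Arguments.
Unset Strict Implicit.
Unset Printing Implicit Defensive.

Local Open Scope classical_set_scope.
Local Open Scope ring_scope.

(* From X_i^V(v^j) = delta^j_i and X_i^C(v^j) = - R^j_il v^l one finds, at a
   point of the constraint submanifold (where v^a = 0) and for any vector A,
     A(X_i^V Lt) - X_i^C Lt = A(X_i^V L) - X_i^C L
       - delta^a_i A(p_a) - X_i^V(p_a) A(v^a) - p_a R^a_i,beta v^beta,
   where Lt = L - p_a v^a. Differentiating the invariance of L and of the
   X_alpha along the group gives X_b^C L = 0 and [X_b, X_alpha] = 0. For i = b
   the Euler-Lagrange equation of Lt is therefore g_ba A(v^a) = 0, so A is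
   tangent to the constraints; for i = alpha it then reads
     A(X_alpha^V L) - X_alpha^C L = p_a R^a_alpha,beta v^beta,
   which differs from the nonholonomic equation by the right-hand side only,
   and (g_alpha,beta) being nonsingular a second-order tangent field is
   determined by the left-hand side. The extra condition of strong consistency
   is X_a^C L = 0 once R^b_a,alpha = 0, hence automatic. *)

(** * Differential calculus *)

Section Calculus.
Variable R : realType.
Implicit Types U V W : normedModType R.

(** The first-order remainder of [f] at [x] is also that of [g] near [x], so ['d f x] serves as
    differential of [g]. Many formulas below hold only over an open domain, and differentiability
    has to be carried across such local equalities. *)
Lemma near_eq_differentiable V W (f g : V -> W) (x : V) :
  {near x, f =1 g} -> differentiable f x -> differentiable g x.
Proof.
move=> fg df.
have fgx : f x = g x by exact: nbhs_singleton fg.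
have dgx : g \o shift x = cst (g x) + 'd f x +o_ 0 id.
  apply/eqaddoP => e e0.
  have /eqaddoP/(_ e e0) dfx := diff_locally df.
  have fg0 : \forall y \near 0, f (y + x) = g (y + x).
    by move: fg; rewrite (near_shift 0) subr0.
  near=> y.
  have <- : (f \o shift x - (cst (f x) + 'd f x)) y =
            (g \o shift x - (cst (g x) + 'd f x)) y.
    rewrite !fctE /= fgx; congr (_ - _).
    by near: y.
  by near: y.
have dfc := diff_continuous df.
apply/diff_locallyP; rewrite (diff_unique dfc dgx); split=> //.
Unshelve. all: by end_near. Qed.

Lemma derive_comp U V W (f : U -> V) (g : V -> W) (x v : U) :
  differentiable f x -> differentiable g (f x) ->
  'D_v (fun y => g (f y)) x = 'D_('D_v f x) g (f x).
Proof.
move=> df dg; rewrite (deriveE _ dg) (deriveE _ df).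
have dgf : differentiable (g \o f) x by exact: differentiable_comp.
by rewrite -/(g \o f) (deriveE _ dgf) (diff_comp df dg).
Qed.

Lemma derive_pair U V W (f : U -> V) (g : U -> W) (x v : U) :
  differentiable f x -> differentiable g x ->
  'D_v (fun y => (f y, g y)) x = ('D_v f x, 'D_v g x).
Proof.
move=> df dg; rewrite deriveE ?diff_pair//; last exact: differentiable_pair.
by rewrite !deriveE.
Qed.

Lemma derive_dirB V W (f : V -> W) (x v w : V) : differentiable f x ->
  'D_(v - w) f x = 'D_v f x - 'D_w f x.
Proof. by move=> df; rewrite !deriveE// linearB. Qed.

Lemma derive_dir_sum V W (I : finType) (c : I -> R) (e : I -> V)
    (f : V -> W) (x : V) : differentiable f x ->
  'D_(\sum_i c i *: e i) f x = \sum_i c i *: 'D_(e i) f x.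
Proof.
move=> df; rewrite deriveE// linear_sum; apply: eq_bigr => i _.
by rewrite linearZ /= deriveE.
Qed.

(** * Partial derivatives on a product space *)

Lemma derive_pairl U V W (H : U * V -> W) (a : U) (b : V) (v : U) :
  'D_v (fun y => H (y, b)) a = 'D_(v, 0) H (a, b).
Proof.
rewrite /derive; set F1 := (X in X @ _); set F2 := (X in _ = lim (X @ _)).
suff -> : F1 = F2 by [].
apply/funext => h; rewrite /F1 /F2 /=.
suff -> : h *: (v, 0) + (a, b) = (h *: v + a, b) by [].
by congr (_, _); rewrite /= scaler0 add0r.
Qed.

Lemma derive_pairr U V W (H : U * V -> W) (a : U) (b v : V) :
  'D_v (fun y => H (a, y)) b = 'D_(0, v) H (a, b).
Proof.
rewrite /derive; set F1 := (X in X @ _); set F2 := (X in _ = lim (X @ _)).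
suff -> : F1 = F2 by [].
apply/funext => h; rewrite /F1 /F2 /=.
suff -> : h *: (0, v) + (a, b) = (a, h *: v + b) by [].
by congr (_, _); rewrite /= scaler0 add0r.
Qed.

Lemma differentiable_pairl U V W (f : U * V -> W) x y :
  differentiable f (x, y) -> differentiable (fun x => f (x, y)) x.
Proof.
by move=> df; apply: (@differentiable_comp _ _ _ _ (fun x => (x, y)) f) => //.
Qed.

Lemma differentiable_pairr U V W (f : U * V -> W) x y :
  differentiable f (x, y) -> differentiable (fun y => f (x, y)) y.
Proof.
by move=> df; apply: (@differentiable_comp _ _ _ _ (fun y => (x, y)) f) => //.
Qed.

Lemma derive_dir_sum_snd U V W (I : finType)
    (d : I -> R) (e : I -> V) (f : U * V -> W) z : differentiable f z ->
  'D_(0, \sum_i d i *: e i) f z = \sum_i d i *: 'D_(0, e i) f z.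
Proof.
case: z => x y df; rewrite -derive_pairr derive_dir_sum.
  by apply: eq_bigr => i _; rewrite derive_pairr.
exact: (differentiable_pairr df).
Qed.

Lemma differentiable_fst U V (z : U * V) : differentiable fst z.
Proof.
have := @linear_differentiable R (U * V)%type U fst z.
by apply=> y; exact: cvg_fst.
Qed.

Lemma differentiable_snd U V (z : U * V) : differentiable snd z.
Proof.
have := @linear_differentiable R (U * V)%type V snd z.
by apply=> y; exact: cvg_snd.
Qed.

Lemma derive_fstE U V (z v : U * V) : 'D_v (@fst U V) z = v.1.
Proof.
rewrite (deriveE _ (@differentiable_fst _ _ z)).
by rewrite (@diff_lin R (U * V)%type U fst)// => y; exact: cvg_fst.
Qed.

Lemma derive_sndE U V (z v : U * V) : 'D_v (@snd U V) z = v.2.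
Proof.
rewrite (deriveE _ (@differentiable_snd _ _ z)).
by rewrite (@diff_lin R (U * V)%type V snd)// => y; exact: cvg_snd.
Qed.

(** * Finite sums and products, matrix entries, determinants and inverses *)

Lemma differentiable_bigsum V W (I : Type) (s : seq I) (P : pred I)
    (f : I -> V -> W) (x : V) : (forall i, differentiable (f i) x) ->
  differentiable (fun y => \sum_(i <- s | P i) f i y) x.
Proof.
move=> df; elim: s => [|i s IHs].
  under eq_fun do rewrite big_nil; exact: differentiable_cst.
under eq_fun do rewrite big_cons.
by case: (P i) => //; exact: differentiableD.
Qed.

Lemma differentiable_bigprod V (I : Type) (s : seq I) (P : pred I)
    (f : I -> V -> R) (x : V) : (forall i, differentiable (f i) x) ->
  differentiable (fun y => \prod_(i <- s | P i) f i y) x.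
Proof.
move=> df; elim: s => [|i s IHs].
  under eq_fun do rewrite big_nil; exact: differentiable_cst.
under eq_fun do rewrite big_cons.
by case: (P i) => //; exact: differentiableM.
Qed.

Lemma derive_bigsum V W (I : finType) (f : I -> V -> W) (x v : V) :
  (forall i, differentiable (f i) x) ->
  'D_v (fun y => \sum_i f i y) x = \sum_i 'D_v (f i) x.
Proof.
move=> df.
suff : forall s : seq I, 'D_v (fun y => \sum_(i <- s) f i y) x
   = \sum_(i <- s) 'D_v (f i) x by exact.
elim=> [|i s IHs].
  by under eq_fun do rewrite big_nil; rewrite derive_cst big_nil.
under eq_fun do rewrite big_cons.
rewrite big_cons -IHs deriveD//; apply: diff_derivable => //.
exact: differentiable_bigsum.
Qed.

Lemma derive_mul V (f g : V -> R) (x v : V) :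
  differentiable f x -> differentiable g x ->
  'D_v (fun y => f y * g y) x = f x * 'D_v g x + g x * 'D_v f x.
Proof. by move=> df dg; rewrite deriveM//; exact: diff_derivable. Qed.

Lemma differentiable_entry V m n (f : V -> 'M[R]_(m, n)) (x : V) i j :
  differentiable f x -> differentiable (fun y => f y i j) x.
Proof.
move=> df; apply: (@differentiable_comp _ _ _ _ f (fun M => M i j)) => //.
exact: differentiable_coord.
Qed.

Lemma derive_entry V m n (f : V -> 'M[R]_(m, n)) (x v : V) i j :
  differentiable f x -> 'D_v (fun y => f y i j) x = ('D_v f x) i j.
Proof.
by move=> df; rewrite derive_mx ?mxE//; exact: diff_derivable.
Qed.

Lemma differentiable_det V n (A : V -> 'M[R]_n) (x : V) :
  (forall i j, differentiable (fun y => A y i j) x) ->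
  differentiable (fun y => \det (A y)) x.
Proof.
move=> dA; apply: differentiable_bigsum => s.
apply: differentiableM; first exact: differentiable_cst.
by apply: differentiable_bigprod => i.
Qed.

(** Cramer's formula: each entry is a cofactor divided by the determinant. Since [invmx] returns its
    argument on a singular matrix, the formula is valid only where the matrix is invertible, hence
    the hypothesis on a whole neighbourhood. *)
Lemma differentiable_invmx V n (A : V -> 'M[R]_n) (x : V) i j :
  (\forall y \near x, A y \in unitmx) ->
  (forall i j, differentiable (fun y => A y i j) x) ->
  differentiable (fun y => invmx (A y) i j) x.
Proof.
move=> uA dA.
pose f y : R := (\det (A y))^-1 * cofactor (A y) j i.
suff df : differentiable f x.
  apply: (near_eq_differentiable _ df).
  near=> y; rewrite /f /invmx ifT; last by near: y.
  by rewrite !mxE.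
apply: differentiableM.
  apply: differentiableV; first exact: differentiable_det.
  by have := nbhs_singleton uA; rewrite unitmxE unitfE.
apply: differentiableM; first exact: differentiable_cst.
by apply: differentiable_det => k l; under eq_fun do rewrite !mxE.
Unshelve. all: by end_near. Qed.

(* The mean value theorem in the direction v, applied to f (. + h w) - f,
   reduces the estimate to the differentiability of 'D_v f at x alone. *)
Lemma second_difference_approx V (f : V -> R) (x v w : V) (e : R) : 0 < e ->
  (\forall y \near x, differentiable f y) -> differentiable ('D_v f) x ->
  exists2 r : R, 0 < r & forall h, 0 < h < r ->
  `|f (h *: v + (h *: w + x)) - f (h *: v + x) - (f (h *: w + x) - f x)
    - h ^+ 2 * 'D_w ('D_v f) x| <= e * h ^+ 2.
Proof.
(* The two displacements sampled below have norms at most [h * |v|] and [h * (|v| + |w|)], so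
   [h * K] bounds their sum; the summand [1] makes [K] positive. *)
move=> e0 df dg; pose K := `|v| + (`|v| + `|w|) + 1.
have K0 : 0 < K by rewrite /K ltr_wpDl// !addr_ge0.
have eK0 : 0 < e / K by rewrite divr_gt0.
have near0 : \forall y \near 0, differentiable f (y + x) /\
    `|'D_v f (y + x) - ('D_v f x + 'd ('D_v f) x y)| <= e / K * `|y|.
  have /eqaddoP/(_ _ eK0) h2 := diff_locally dg.
  have h1 : \forall y \near 0, differentiable f (y + x).
    by move: df; rewrite (near_shift 0) subr0.
  by near=> y; split; near: y.
have [r /= r0 hr] := (nbhs_ballP _ _).1 near0.
exists (r / K); first by rewrite divr_gt0.
move=> h /andP[h0 hrK].
have hK : h * K < r by rewrite -ltr_pdivlMr.
(* The boolean [t] switches the displacement [h *: w] on or off, so that the segments in direction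
   [v] from [x] and from [h *: w + x] are treated at once. *)
have in_ball s (t : bool) : 0 <= s <= h ->
   `|s *: v + t%:R *: (h *: w)| <= h * (`|v| + (t%:R : R) * `|w|).
  move=> /andP[s0 sh]; rewrite (le_trans (ler_normD _ _))// mulrDr lerD//.
    by rewrite normrZ ger0_norm// ler_wpM2r.
  rewrite !normrZ (ger0_norm (ltW h0)) [ `|t%:R|]ger0_norm ?ler0n//.
  by rewrite mulrCA.
have {}hr s (t : bool) : 0 <= s <= h ->
    let y := s *: v + t%:R *: (h *: w) in differentiable f (y + x) /\
    `|'D_v f (y + x) - ('D_v f x + 'd ('D_v f) x y)| <= e / K * `|y|.
  move=> sh y; apply: hr; rewrite -ball_normE /ball_/= sub0r normrN.
  apply: (le_lt_trans (in_ball _ _ sh)); apply: le_lt_trans hK.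
  rewrite ler_pM2l// /K; case: (t); rewrite ?mul1r ?mul0r.
    by rewrite -[leLHS]add0r -addrA lerD// lerDl.
  by rewrite addr0 -addrA lerDl !addr_ge0.
pose phi s := f (s *: v + (h *: w + x)) - f (s *: v + x).
pose dphi s := 'D_v f (s *: v + (h *: w + x)) - 'D_v f (s *: v + x).
have line z s : differentiable f (s *: v + z) ->
    is_derive s 1 (fun s => f (s *: v + z)) ('D_v f (s *: v + z)).
  move=> dfz.
  have dl : differentiable (fun s : R => s *: v + z) s by [].
  have dl1 : 'D_1 (fun s : R => s *: v + z) s = v.
    by rewrite (deriveE _ dl) diff_val /= addr0 scale1r.
  apply: DeriveDef; last by rewrite derive_comp// dl1.
  by apply: diff_derivable; exact: differentiable_comp.
have dphiP s : 0 <= s <= h -> is_derive s 1 phi (dphi s).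
  move=> sh.
  have [] := hr s true sh; rewrite scale1r -addrA => /line h1 _.
  have [] := hr s false sh; rewrite scale0r addr0 => /line h2 _.
  exact: is_deriveB.
have [c /[!in_itv]/= /andP[c0 ch]] : exists2 c, c \in `]0, h[ &
    phi h - phi 0 = dphi c * (h - 0).
  apply: MVT => //.
    by move=> s /[!in_itv]/= /andP[s0 sh]; apply: dphiP; rewrite !ltW.
  apply: derivable_within_continuous => s /[!in_itv]/= sh.
  by have [] := dphiP s sh.
rewrite /phi !scale0r !add0r subr0 => ->.
have sc : 0 <= c <= h by rewrite !ltW.
have [_] := hr c true sc; have [_] := hr c false sc.
have := in_ball c true sc; have := in_ball c false sc.
rewrite scale0r !addr0 scale1r mul0r mul1r addr0 -addrA.
set y0 := c *: v; set y1 := _ + _.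
have -> : c *: v + (h *: w + x) = y1 + x.
  by rewrite /y1 addrA.
move=> b0 b1 a0 a1.
(* The linear parts of the expansions of ['D_v f] at the two points differ by exactly [h] times the
   mixed derivative, so only two remainders are left to bound. *)
have -> : dphi c * h - h ^+ 2 * 'D_w ('D_v f) x =
  h * (('D_v f (y1 + x) - ('D_v f x + 'd ('D_v f) x y1))
    - ('D_v f (y0 + x) - ('D_v f x + 'd ('D_v f) x y0))).
  have dy1 : 'd ('D_v f) x y1 = 'd ('D_v f) x y0 + h * 'd ('D_v f) x w.
    by rewrite /y1 linearD; congr (_ + _); exact: linearZ.
  rewrite (deriveE _ dg) dy1 /dphi addrA -/y0 -/y1; ring.
rewrite normrM (ger0_norm (ltW h0)) expr2 mulrCA ler_pM2l//.
rewrite (le_trans (ler_normB _ _))//.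
apply: (le_trans (lerD a1 a0)); rewrite -mulrDr.
rewrite mulrAC ler_pdivrMr// -mulrA ler_pM2l//.
rewrite (le_trans (lerD b1 b0))// -mulrDr ler_pM2l// /K.
by rewrite addrC lerDl.
Unshelve. all: by end_near. Qed.

(** The second difference is symmetric in [v] and [w], and it approximates [h ^+ 2] times either
    mixed derivative with error at most [e / 2 * h ^+ 2]. The two mixed derivatives are thus within
    [e] of each other, for every positive [e]. *)
Lemma derive_sym V (f : V -> R) (x v w : V) :
  (\forall y \near x, differentiable f y) ->
  differentiable ('D_v f) x -> differentiable ('D_w f) x ->
  'D_w ('D_v f) x = 'D_v ('D_w f) x.
Proof.
move=> df dv dw; apply/eqP; rewrite -subr_eq0 -normr_le0.
apply/ler_addgt0Pr => e e0; rewrite add0r.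
have e2 : 0 < e / 2 by rewrite divr_gt0.
have [r r0 hr] := second_difference_approx w e2 df dv.
have [s s0 hs] := second_difference_approx v e2 df dw.
pose h := Num.min r s / 2.
have rs0 : 0 < Num.min r s by rewrite lt_min r0.
have h0 : 0 < h by rewrite divr_gt0.
have hrs : h < Num.min r s by rewrite ltr_pdivrMr// mulr2n mulrDr mulr1 ltrDl.
move: (hrs); rewrite lt_min => /andP[h_r h_s].
have := hr h; have := hs h; rewrite h0 h_r h_s => /(_ isT) B /(_ isT) A.
have h20 : 0 < h ^+ 2 by rewrite exprn_gt0.
rewrite -(ler_pM2l h20) -{1}(ger0_norm (ltW h20)) -normrM.
have -> : h ^+ 2 * e = e / 2 * h ^+ 2 + e / 2 * h ^+ 2 by field.
apply: le_trans (lerD B A); apply: le_trans (ler_normB _ _).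
rewrite (addrCA (h *: v)).
have alg (p q t u a b c : R) : c * (a - b) =
    (p - t - (q - u) - c * b) - (p - q - (t - u) - c * a) by ring.
by rewrite -alg.
Qed.

(** Entrywise reduction to the scalar case; the derivative of an entry is the entry of the
    derivative near [x], where [f] is differentiable. *)
Lemma derive_sym_row V n (f : V -> 'rV[R]_n) (x v w : V) :
  (\forall y \near x, differentiable f y) ->
  differentiable ('D_v f) x -> differentiable ('D_w f) x ->
  'D_w ('D_v f) x = 'D_v ('D_w f) x.
Proof.
move=> df dv dw; apply/rowP => j.
have E u : \forall y \near x, 'D_u (fun y => f y 0 j) y = 'D_u f y 0 j.
  by near do rewrite derive_entry//.
have dE u : differentiable ('D_u f) x ->
    differentiable ('D_u (fun y => f y 0 j)) x.
  move=> du; have := differentiable_entry 0 j du.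
  by apply: near_eq_differentiable; apply: filterS (E u) => y ->.
have dd u t : differentiable ('D_u f) x ->
    'D_t ('D_u f) x 0 j = 'D_t ('D_u (fun y => f y 0 j)) x.
  move=> du; apply: etrans (esym (derive_entry t 0 j du)) _.
  by apply: near_eq_derive; apply: filterS (E u) => y ->.
apply: etrans (dd _ _ dv) _; apply: etrans _ (esym (dd _ _ dw)).
apply: derive_sym; [|exact: dE|exact: dE].
by near=> y; apply: differentiable_entry; near: y.
Unshelve. all: by end_near. Qed.

Lemma smooth_on_derive V W (A : set V) (f : V -> W) (v : V) :
  smooth_on A f -> smooth_on A ('D_v f).
Proof. by move=> sf r; exact: (sf r.+1).2. Qed.

Lemma smooth_on_differentiable V W (A : set V) (f : V -> W) x :
  smooth_on A f -> A x -> differentiable f x.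
Proof. by move=> sf; exact: (sf 1).1. Qed.

End Calculus.

(** * Infinitesimal invariance *)

Section Action.
Variables (R : realType) (m k : nat) (G : lie_group R k)
  (Q : manifold R (m + k)) (S : chaplygin G Q) (F : adapted_frame S).
Local Notation n := (m + k)%N.
Local Notation E := 'rV[R]_n.
Local Notation b := (fr_gchart F).
Local Notation c := (fr_chart F).
Local Notation y0 := (cmap b (lg_one G)).

(* The action in charts; its derivatives in the group variable at the identity
   are the fundamental vector fields. *)
Definition local_act (z : 'rV[R]_k * E) : E :=
  cmap c (chap_act S (cinv b z.1) (cinv c z.2)).

Definition local_act_dom : set ('rV[R]_k * E) :=
  [set z | [/\ ccod b z.1, ccod c z.2 &
             cdom c (chap_act S (cinv b z.1) (cinv c z.2))]].

(** The charts and the action are continuous. Openness makes the identities for the local action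
    hold near the identity of the group, where they are to be differentiated. *)
Lemma local_act_dom_open : open local_act_dom.
Proof.
rewrite openE => p [p1 p2 p3]; rewrite /interior.
have h1 : \forall z \near p, ccod b z.1.
  apply: (cvg_fst (open_nbhs_nbhs (conj (@ccod_open _ _ _ b) p1))).
have h2 : \forall z \near p, ccod c z.2.
  apply: (cvg_snd (open_nbhs_nbhs (conj (@ccod_open _ _ _ c) p2))).
have h3 : \forall z \near p, cdom c (chap_act S (cinv b z.1) (cinv c z.2)).
  have cp : {for p, continuous
      (fun z => (cinv b z.1, cinv c z.2) : G * Q)}.
    apply: cvg_pair => /=.
      apply: (@cvg_comp _ _ _ fst (cinv b)); first exact: cvg_fst.
      exact: cinv_cont.
    apply: (@cvg_comp _ _ _ snd (cinv c)); first exact: cvg_snd.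
    exact: cinv_cont.
  have ca := (act_smooth (chap_act S)).1 (cinv b p.1, cinv c p.2).
  have := cvg_comp _ _ cp ca; apply.
  exact: (open_nbhs_nbhs (conj (@cdom_open _ _ _ c) p3)).
by near=> z; split; near: z.
Unshelve. all: by end_near. Qed.

Lemma local_act_smooth : smooth_on local_act_dom local_act.
Proof. exact: (act_smooth (chap_act S)).2 (fr_gchart_atlas F)
  (fr_chart_atlas F) (fr_chart_atlas F). Qed.

Lemma local_act_dom1 x : ccod c x -> local_act_dom (y0, x).
Proof.
move=> cx; split=> //=; first by apply: cmapP; exact: fr_gchart_one.
by rewrite cmapK ?act1; [exact: cinvP | exact: fr_gchart_one].
Qed.

Lemma local_act1 x : ccod c x -> local_act (y0, x) = x.
Proof.
move=> cx; rewrite /local_act /= cmapK; last exact: fr_gchart_one.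
by rewrite act1 cinvK.
Qed.

Lemma local_act_differentiable z : local_act_dom z ->
  differentiable local_act z.
Proof. exact: (local_act_smooth 1).1. Qed.

Lemma derive_local_act_differentiable v z : local_act_dom z ->
  differentiable ('D_v local_act) z.
Proof. exact: ((local_act_smooth 2).2 v).1. Qed.

Lemma local_act_near z : local_act_dom z -> nbhs z local_act_dom.
Proof.
by move=> dz; apply: open_nbhs_nbhs; split=> //; exact: local_act_dom_open.
Qed.

Lemma local_act_near1 x : ccod c x -> \forall y \near y0, local_act_dom (y, x).
Proof.
move=> cx; have /= cc : {for y0, continuous (fun y => (y, x))}.
  by apply: differentiable_continuous; exact: differentiable_pair.
exact: (cc _ (local_act_near (local_act_dom1 cx))).
Qed.

Lemma frm_vE a x : frm_v F a x = 'D_(fr_basis F a, 0) local_act (y0, x).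
Proof.
rewrite /frm_v /frm /frame_field -[rshift m a]/(unsplit (inr a)) unsplitK.
exact: (derive_pairl local_act).
Qed.

Lemma frm_hE al x : frm_h F al x = fr_hor F al x.
Proof.
by rewrite /frm_h /frm /frame_field -[lshift k al]/(unsplit (inl al)) unsplitK.
Qed.

Lemma derive_local_act1 x u : ccod c x -> 'D_(0, u) local_act (y0, x) = u.
Proof.
move=> cx; rewrite -derive_pairr.
rewrite (@near_eq_derive _ _ _ _ id) ?derive_id//.
near=> x'; apply: local_act1; near: x'.
exact: (open_nbhs_nbhs (conj (@ccod_open _ _ _ c) cx)).
Unshelve. all: by end_near. Qed.

(** Symmetry of the mixed partial derivatives of the local action: differentiating a fundamental
    field along [u] amounts to differentiating, in the group variable, the tangent map of the action
    applied to [u]. *)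
Lemma derive_frm_v a x u : ccod c x ->
  'D_u (frm_v F a) x =
  'D_(fr_basis F a) (fun y => 'D_(0, u) local_act (y, x)) y0.
Proof.
move=> cx; have dx := local_act_dom1 cx.
have -> : frm_v F a = fun x => 'D_(fr_basis F a, 0) local_act (y0, x).
  by apply/funext => x'; exact: frm_vE.
rewrite (derive_pairr ('D_(fr_basis F a, 0) local_act)).
rewrite (derive_pairl ('D_(0, u) local_act)).
apply: derive_sym_row; try exact: derive_local_act_differentiable.
by apply: filterS (local_act_near dx) => z; exact: local_act_differentiable.
Qed.

(** * Consequences of the invariance of the Lagrangian and of the horizontal frame *)

Lemma lagr_smooth : smooth_on [set z | ccod c z.1] (lagr F).
Proof. exact: tfun_smooth (fr_chart_atlas F). Qed.

Lemma lagr_local_act y x u : local_act_dom (y, x) ->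
  lagr F (local_act (y, x), 'D_(0, u) local_act (y, x)) = lagr F (x, u).
Proof.
move=> [h1 h2 h3]; rewrite -derive_pairr.
have L_inv := @chap_L_invariant _ _ _ _ _ S.
exact: (L_inv (cinv b y) c c (x, u) (fr_chart_atlas F) (fr_chart_atlas F)
  (conj h2 h3)).
Qed.

(** Here [psi] moves [(x, u)] by the lifted action on the tangent bundle. Its derivative at the
    identity is the complete lift of the fundamental field, while the Lagrangian is constant along
    [psi]. *)
Lemma Cl_frm_v_lagr a z : ccod c z.1 -> Cl (frm_v F a) (lagr F) z = 0.
Proof.
case: z => x u /= cx; have dx := local_act_dom1 cx.
pose psi y := (local_act (y, x), 'D_(0, u) local_act (y, x)).
have dp1 : differentiable (fun y => local_act (y, x)) y0.
  exact: differentiable_pairl (local_act_differentiable dx).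
have dp2 : differentiable (fun y => 'D_(0, u) local_act (y, x)) y0.
  exact: (differentiable_pairl (derive_local_act_differentiable _ dx)).
have dpsi : differentiable psi y0 by exact: differentiable_pair.
have psi0 : psi y0 = (x, u).
  by rewrite /psi local_act1// derive_local_act1.
have dpsi0 : 'D_(fr_basis F a) psi y0 = complete_lift (frm_v F a) (x, u).
  rewrite derive_pair// /complete_lift /= derive_frm_v// frm_vE.
  by rewrite (derive_pairl local_act).
rewrite /Cl /apply_field -dpsi0 -psi0 -derive_comp//; last first.
  by rewrite psi0; exact: (lagr_smooth 1).1.
rewrite (@near_eq_derive _ _ _ _ (cst (lagr F (x, u)))) ?derive_cst//.
by apply: filterS (local_act_near1 cx) => y; exact: lagr_local_act.
Qed.

(** Invariance says that the horizontal field at the moved point is the tangent map applied to the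
    field at [x]. Differentiated in the group variable at the identity, the two sides become the two
    terms of the bracket. *)
Lemma bracket_frm_vh a al x : fr_dom F x ->
  bracket (frm_v F a) (frm_h F al) x = 0.
Proof.
move=> fx; have cx := fr_dom_sub fx; have dx := local_act_dom1 cx.
have -> : frm_h F al = fr_hor F al by apply/funext => x'; exact: frm_hE.
apply/eqP; rewrite subr_eq0; apply/eqP.
have dp1 : differentiable (fun y => local_act (y, x)) y0.
  exact: differentiable_pairl (local_act_differentiable dx).
rewrite derive_frm_v// frm_vE -(derive_pairl local_act).
have dh : differentiable (fr_hor F al) (local_act (y0, x)).
  by rewrite local_act1//; exact: (fr_hor_smooth F al 1).1.
transitivity
    ('D_(fr_basis F a) (fun y => fr_hor F al (local_act (y, x))) y0).
  by rewrite (derive_comp _ dp1 dh) local_act1.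
apply: near_eq_derive.
(* Invariance of the frame is available only while the moved point stays in [fr_dom F]; by
   continuity it does so for group elements near the identity. *)
have fn : \forall y \near y0, fr_dom F (local_act (y, x)).
  apply: (differentiable_continuous dp1).
  rewrite local_act1//.
  exact: open_nbhs_nbhs (conj (@fr_dom_open _ _ _ _ _ _ F) fx).
near=> y.
have [h1 h2 h3] : local_act_dom (y, x) by near: y; exact: local_act_near1.
rewrite -derive_pairr.
apply: (@fr_hor_invariant _ _ _ _ _ _ F al (cinv b y) x fx (conj h2 h3)).
by near: y.
Unshelve. all: by end_near. Qed.

End Action.

(** * Quasi-velocities and frame derivatives *)

Section Frame.
Variables (R : realType) (m k : nat) (G : lie_group R k)
  (Q : manifold R (m + k)) (S : chaplygin G Q) (F : adapted_frame S).
Local Notation n := (m + k)%N.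
Local Notation E := 'rV[R]_n.
Local Notation y0 := (cmap (fr_gchart F) (lg_one G)).
Local Notation chart_dom := [set z : E * E | ccod (fr_chart F) z.1].

Lemma tangent_dom_chart z : tangent_dom F z -> chart_dom z.
Proof. exact: fr_dom_sub. Qed.

Lemma tangent_dom_near z : tangent_dom F z -> nbhs z (tangent_dom F).
Proof.
move=> fz; apply: (cvg_fst (open_nbhs_nbhs (conj (@fr_dom_open _ _ _ _ _ _ F) fz))).
Qed.

Lemma constr_tangent_dom z : constr F z -> tangent_dom F z.
Proof. by case. Qed.

Lemma frm_differentiable i x : fr_dom F x -> differentiable (frm F i) x.
Proof.
move=> fx; rewrite -(splitK i); case: (fintype.split i) => [al|a] /=.
  have -> : frm F (lshift k al) = fr_hor F al by apply/funext => x'; exact: frm_hE.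
  exact: smooth_on_differentiable (fr_hor_smooth F al) fx.
have -> : frm F (rshift m a) =
    fun x : E => 'D_(fr_basis F a, 0) (local_act F) (y0, x).
  by apply/funext => x'; exact: frm_vE.
have dx := local_act_dom1 (fr_dom_sub fx).
exact: (differentiable_pairr (derive_local_act_differentiable _ dx)).
Qed.

(** * Components in the frame and derivatives of the quasi-velocities *)

Lemma components_sum (I : finType) (d : I -> R) (e : I -> E) x :
  components F x (\sum_i d i *: e i) = \sum_i d i *: components F x (e i).
Proof.
by rewrite /components mulmx_suml; apply: eq_bigr => i _; rewrite scalemxAl.
Qed.

Lemma components_frm i x : fr_dom F x ->
  components F x (frm F i x) = delta_mx 0 i.
Proof.
move=> fx; rewrite /components -[frm F i x](rowK (fun i => frm F i x)) rowE.
by rewrite mulmxK//; exact: fr_frameP.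
Qed.

Lemma componentsK x w : fr_dom F x ->
  \sum_i components F x w 0 i *: frm F i x = w.
Proof.
move=> fx; rewrite -[RHS](mulmxKV (fr_frameP fx)) mulmx_sum_row.
by apply: eq_bigr => i _; rewrite rowK.
Qed.

Lemma components_frm_sum (d : 'I_n -> R) x j : fr_dom F x ->
  components F x (\sum_i d i *: frm F i x) 0 j = d j.
Proof.
move=> fx; rewrite components_sum summxE (bigD1 j)//= big1 => [|i ij].
  by rewrite components_frm// !mxE !eqxx mulr1 addr0.
by rewrite components_frm// !mxE (negPf (_ : j != i)) ?mulr0// eq_sym.
Qed.

Lemma qv_differentiable j z : tangent_dom F z -> differentiable (qv F j) z.
Proof.
move=> fz.
pose A z' := \matrix_(i < n) frm F i (fst (z' : E * E)).
have -> : qv F j = fun z => \sum_i snd z 0 i * invmx (A z) i j.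
  by apply/funext => z'; rewrite /qv /components mxE.
apply: differentiable_bigsum => i; apply: differentiableM.
  apply: differentiable_entry; exact: differentiable_snd.
apply: differentiable_invmx.
  by apply: filterS (tangent_dom_near fz) => z' ?; exact: fr_frameP.
move=> i' j'; rewrite (_ : (fun _ => _) = fun z => frm F i' (fst z) 0 j').
  apply: differentiable_entry.
  apply: (@differentiable_comp _ _ _ _ fst (frm F i')).
    exact: differentiable_fst.
  exact: frm_differentiable.
by apply/funext => z'; rewrite /A !mxE.
Qed.

Lemma derive_frm_fst i j z w : tangent_dom F z ->
  differentiable (fun z => frm F i (fst z) 0 j) z /\
  'D_w (fun z => frm F i (fst z) 0 j) z = 'D_(w.1) (frm F i) z.1 0 j.
Proof.
move=> fz; have dX := frm_differentiable i fz.
have df : differentiable (fun z => frm F i (fst z)) z.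
  apply: (@differentiable_comp _ _ _ _ fst (frm F i)) => //.
  exact: differentiable_fst.
split; first exact: differentiable_entry.
by rewrite derive_entry// (@derive_comp _ _ _ _ fst (frm F i))// derive_fstE.
Qed.

(** The identity [u = v^i X_i(q)] is differentiated along [w] and solved for the derivatives of the
    [v^i], so that no formula for the derivative of an inverse matrix is required. *)
Lemma derive_qv j z w : tangent_dom F z -> 'D_w (qv F j) z =
  components F z.1 (w.2 - \sum_i qv F i z *: 'D_(w.1) (frm F i) z.1) 0 j.
Proof.
move=> fz; suff <- : \sum_i 'D_w (qv F i) z *: frm F i z.1 =
    w.2 - \sum_i qv F i z *: 'D_(w.1) (frm F i) z.1.
  by rewrite components_frm_sum.
apply/eqP; rewrite -subr_eq opprK; apply/eqP/rowP => l.
rewrite -big_split summxE/=.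
have dqX i : differentiable (fun z => qv F i z * frm F i (fst z) 0 l) z.
  apply: differentiableM; first exact: qv_differentiable.
  exact: (derive_frm_fst i l 0 fz).1.
transitivity ('D_w (fun z => \sum_i qv F i z * frm F i (fst z) 0 l) z).
  rewrite derive_bigsum//; apply: eq_bigr => i _.
  have [dX DX] := derive_frm_fst i l w fz.
  rewrite derive_mul//; last exact: qv_differentiable.
  by rewrite DX !mxE addrC mulrC [X in _ + X]mulrC mulrC [X in _ + X]mulrC.
have -> : w.2 0 l = 'D_w (fun z : E * E => snd z 0 l) z.
  by rewrite derive_entry ?derive_sndE//; exact: differentiable_snd.
apply: near_eq_derive; apply: filterS (tangent_dom_near fz) => z' fz'.
rewrite -[in RHS](componentsK z'.2 fz') summxE.
by apply: eq_bigr => i _; rewrite mxE.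
Qed.

Lemma Vl_qv i j z : tangent_dom F z -> Vl (frm F i) (qv F j) z = (j == i)%:R.
Proof.
move=> fz; rewrite /Vl /apply_field derive_qv//= big1 => [|l _].
  by rewrite subr0 components_frm// mxE.
by rewrite derive0 scaler0.
Qed.

(** Expanding the velocity as [v^l X_l] in the fibre part of the complete lift gives
    [v^l D_(X_l) X_i]; subtracting [v^l D_(X_i) X_l] leaves [- v^l [X_i, X_l]]. *)
Lemma Cl_qv i j z : tangent_dom F z ->
  Cl (frm F i) (qv F j) z = - \sum_l qv F l z * Rf F i l j z.1.
Proof.
move=> fz; rewrite /Cl /apply_field derive_qv//=.
have dX := frm_differentiable i fz.
have -> : 'D_z.2 (frm F i) z.1 = \sum_l qv F l z *: 'D_(frm F l z.1) (frm F i) z.1.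
  by rewrite -{1}(componentsK z.2 fz) derive_dir_sum.
rewrite -sumrB.
have -> : - (\sum_l qv F l z * Rf F i l j z.1) =
    \sum_l (- qv F l z) * Rf F i l j z.1.
  by rewrite -sumrN; apply: eq_bigr => l _; rewrite mulNr.
rewrite (eq_bigr (fun l => - qv F l z *: bracket (frm F i) (frm F l) z.1)).
  rewrite components_sum summxE; apply: eq_bigr => l _.
  by rewrite mxE.
by move=> l _; rewrite /bracket scaleNr scalerBr opprB.
Qed.

(** Smoothness in the sense of [smooth_on] concerns derivatives in constant directions; this
    expansion reduces a vertical lift to those, with coefficients depending on the base point. *)
Lemma Vl_sum i f z : differentiable f z -> Vl (frm F i) f z =
  \sum_j frm F i z.1 0 j * 'D_(0, delta_mx 0 j) f z.
Proof.
move=> df; rewrite /Vl /apply_field /vertical_lift.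
by rewrite {1}[frm F i z.1]row_sum_delta derive_dir_sum_snd.
Qed.

Lemma Vl_differentiable i f z : smooth_on chart_dom f -> tangent_dom F z ->
  differentiable (Vl (frm F i) f) z.
Proof.
move=> sf fz.
pose g z := \sum_j frm F i (fst z) 0 j * 'D_(0, delta_mx 0 j) f z.
suff dg : differentiable g z.
  apply: near_eq_differentiable dg.
  apply: filterS (tangent_dom_near fz) => z' fz'; rewrite Vl_sum//.
  exact: smooth_on_differentiable (tangent_dom_chart fz').
apply: differentiable_bigsum => j; apply: differentiableM.
  exact: (derive_frm_fst i j 0 fz).1.
apply: smooth_on_differentiable (tangent_dom_chart fz).
exact: smooth_on_derive.
Qed.

Lemma Vl_lagr_differentiable i z : tangent_dom F z ->
  differentiable (Vl (frm F i) (lagr F)) z.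
Proof. by apply: Vl_differentiable; exact: lagr_smooth. Qed.

Lemma lagr_differentiable z : tangent_dom F z -> differentiable (lagr F) z.
Proof.
by move=> /tangent_dom_chart; apply: smooth_on_differentiable; exact: lagr_smooth.
Qed.

(** The coefficients of [X_j] depend on the base point alone and are annihilated by vertical lifts.
    Hence the Hessian is a combination of single vertical lifts of the smooth fibre derivatives of
    the Lagrangian, to which [Vl_differentiable] applies. *)
Lemma hess_differentiable i j z : tangent_dom F z ->
  differentiable (hess F i j) z.
Proof.
move=> fz; pose e l : E * E := (0, delta_mx 0 l).
have sL l : smooth_on chart_dom ('D_(e l) (lagr F)).
  by apply: smooth_on_derive; exact: lagr_smooth.
pose g z := \sum_l frm F j (fst z) 0 l * Vl (frm F i) ('D_(e l) (lagr F)) z.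
suff dg : differentiable g z.
  apply: near_eq_differentiable dg.
  apply: filterS (tangent_dom_near fz) => z' fz'; rewrite /hess /g.
  pose h z := \sum_l frm F j (fst z) 0 l * 'D_(e l) (lagr F) z.
  have hE : \forall y \near z', h y = Vl (frm F j) (lagr F) y.
    apply: filterS (tangent_dom_near fz') => y fy; rewrite Vl_sum//.
    exact: lagr_differentiable.
  rewrite {2}/Vl /apply_field -(near_eq_derive _ hE) derive_bigsum => [|l].
    apply: eq_bigr => l _.
    have [dX DX] := derive_frm_fst j l (vertical_lift (frm F i) z') fz'.
    rewrite derive_mul// ?DX /= ?derive0 ?mxE ?mulr0 ?addr0//.
    exact: smooth_on_differentiable (tangent_dom_chart fz').
  apply: differentiableM; first exact: (derive_frm_fst j l 0 fz').1.
  exact: smooth_on_differentiable (tangent_dom_chart fz').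
apply: differentiable_bigsum => l; apply: differentiableM.
  exact: (derive_frm_fst j l 0 fz).1.
exact: Vl_differentiable.
Qed.

End Frame.

(** * The Euler-Lagrange equations of L - p_a v^a *)

Section EL.
Variables (R : realType) (m k : nat) (G : lie_group R k)
  (Q : manifold R (m + k)) (S : chaplygin G Q) (F : adapted_frame S).
Local Notation n := (m + k)%N.
Local Notation E := 'rV[R]_n.

(** The velocity lies in the span of the horizontal frame fields, none of which has a component
    along a fundamental field. *)
Lemma qvv_constr a z : constr F z -> qvv F a z = 0.
Proof.
case=> fz; rewrite -fr_hor_span// -[X in span X]/(tval (in_tuple _)).
move=> /coord_span; rewrite /qvv /qv => ->.
rewrite components_sum summxE big1// => i _; rewrite mxE.
have /mapP[al _ ->] : (in_tuple [seq fr_hor F al z.1 | al : 'I_m])`_i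
    \in [seq fr_hor F al z.1 | al : 'I_m] by exact: mem_nth.
rewrite -frm_hE components_frm// mxE eqxx /=.
by rewrite eq_sym (negPf (_ : lshift _ _ != rshift _ _)) ?mulr0// eq_lrshift.
Qed.

Lemma sum_qv_constr (f : 'I_n -> R) z : constr F z ->
  \sum_l qv F l z * f l = \sum_(be < m) qvh F be z * f (lshift k be).
Proof.
move=> cz; rewrite big_split_ord /= [X in _ + X]big1 ?addr0// => a _.
by rewrite [qv _ _ _](qvv_constr a cz) mul0r.
Qed.

Lemma momentum_differentiable a z : tangent_dom F z ->
  differentiable (momentum F a) z.
Proof. exact: Vl_lagr_differentiable. Qed.

Lemma derive_Ltilde w z : tangent_dom F z ->
  'D_w (Ltilde F) z = 'D_w (lagr F) z - \sum_(a < k)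
    (momentum F a z * 'D_w (qvv F a) z + qvv F a z * 'D_w (momentum F a) z).
Proof.
move=> fz.
have dp a := momentum_differentiable a fz.
have dv a : differentiable (qvv F a) z by exact: qv_differentiable.
have dpv a : differentiable (fun z => momentum F a z * qvv F a z) z.
  exact: differentiableM.
have ds : differentiable (fun z => \sum_(a < k) momentum F a z * qvv F a z) z.
  exact: differentiable_bigsum.
have dL := lagr_differentiable fz.
rewrite /Ltilde deriveB; [|exact: diff_derivable|exact: diff_derivable].
rewrite derive_bigsum//; congr (_ - _); apply: eq_bigr => a _.
by rewrite derive_mul.
Qed.

Lemma euler_lagrange_Ltilde (A : E * E -> E * E) i z : constr F z ->
  apply_field A (Vl (frm F i) (Ltilde F)) z - Cl (frm F i) (Ltilde F) z =
  apply_field A (Vl (frm F i) (lagr F)) z - Cl (frm F i) (lagr F) z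
  - \sum_(a < k) ((rshift m a == i)%:R * apply_field A (momentum F a) z
      + hess F i (rshift m a) z * apply_field A (qvv F a) z)
  - \sum_(a < k) momentum F a z *
      \sum_(be < m) qvh F be z * Rf F i (lshift k be) (rshift m a) z.1.
Proof.
move=> cz; have fz := constr_tangent_dom cz.
have -> : Cl (frm F i) (Ltilde F) z = Cl (frm F i) (lagr F) z +
    \sum_(a < k) momentum F a z *
      \sum_(be < m) qvh F be z * Rf F i (lshift k be) (rshift m a) z.1.
  rewrite /Cl /apply_field derive_Ltilde// -sumrN; congr (_ + _).
  apply: eq_bigr => a _; rewrite qvv_constr// mul0r addr0.
  rewrite [X in _ * X](Cl_qv i (rshift m a) fz) mulrN opprK.
  by rewrite (sum_qv_constr _ cz).
suff -> : apply_field A (Vl (frm F i) (Ltilde F)) z =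
    apply_field A (Vl (frm F i) (lagr F)) z - \sum_(a < k)
     ((rshift m a == i)%:R * apply_field A (momentum F a) z
      + hess F i (rshift m a) z * apply_field A (qvv F a) z).
  by rewrite opprD !addrA; congr (_ - _); rewrite addrAC.
(* This is [X_i^V(p_a v^a)] by the product rule: [X_i^V(v^a)] is a Kronecker delta and [X_i^V(p_a)]
   is a Hessian entry. *)
pose h a z := (rshift m a == i)%:R * momentum F a z +
  hess F i (rshift m a) z * qvv F a z.
rewrite /apply_field.
(* The equality is stated on a neighbourhood, points off the constraint submanifold included,
   because [A] is not yet known to be tangent; [v^a = 0] is used only after differentiating. *)
have hE : \forall y \near z, Vl (frm F i) (lagr F) y - \sum_(a < k) h a y =
    Vl (frm F i) (Ltilde F) y.
  apply: filterS (tangent_dom_near fz) => y fy.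
  rewrite [RHS]derive_Ltilde//; congr (_ - _); apply: eq_bigr => a _.
  rewrite [X in _ * X + _](Vl_qv i (rshift m a) fy) /h.
  by rewrite [_%:R * _]mulrC [hess _ _ _ _ * _]mulrC.
have dp a := momentum_differentiable a fz.
have dv a : differentiable (qvv F a) z by exact: qv_differentiable.
have dh1 a : differentiable (fun z => (rshift m a == i)%:R * momentum F a z) z.
  by apply: differentiableM => //; exact: differentiable_cst.
have dh2 a : differentiable (fun z => hess F i (rshift m a) z * qvv F a z) z.
  by apply: differentiableM => //; exact: hess_differentiable.
have dh a : differentiable (h a) z by exact: differentiableD.
have ds : differentiable (fun z => \sum_(a < k) h a z) z.
  exact: differentiable_bigsum.
have dL := Vl_lagr_differentiable i fz.
rewrite -(near_eq_derive _ hE) deriveB;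
  [|exact: diff_derivable|exact: diff_derivable].
rewrite derive_bigsum//; congr (_ - _); apply: eq_bigr => a _.
rewrite /h deriveD; [|exact: diff_derivable|exact: diff_derivable].
have dc : differentiable (fun _ : E * E => (rshift m a == i)%:R : R) z.
  exact: differentiable_cst.
have -> := derive_mul (A z) dc (dp a).
have -> := derive_mul (A z) (hess_differentiable i (rshift m a) fz) (dv a).
by rewrite derive_cst qvv_constr// mulr0 mul0r !addr0.
Qed.

Lemma sum_Rf_rshift a b z : tangent_dom F z ->
  \sum_(be < m) qvh F be z * Rf F (rshift m b) (lshift k be) (rshift m a) z.1
  = 0.
Proof.
move=> fz; apply: big1 => be _; rewrite /Rf.
by rewrite [bracket _ _ _]bracket_frm_vh// /components mul0mx mxE mulr0.
Qed.

Lemma Ltilde_tangent (A : E * E -> E * E) z : regular_g F -> constr F z ->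
  (forall i,
    apply_field A (Vl (frm F i) (Ltilde F)) z - Cl (frm F i) (Ltilde F) z = 0) ->
  forall a, apply_field A (qvv F a) z = 0.
Proof.
move=> hreg cz EL; have fz := constr_tangent_dom cz.
pose v : 'cV[R]_k := \col_a apply_field A (qvv F a) z.
suff v0 : v = 0.
  by move=> a; have /colP/(_ a) := v0; rewrite !mxE.
rewrite -(mulKmx (hreg _ fz) v); apply/eqP.
suff -> : \matrix_(a < k, b0 < k) hess F (rshift m a) (rshift m b0) z *m v = 0.
  by rewrite mulmx0.
apply/colP => b; rewrite !mxE.
have := EL (rshift m b); rewrite euler_lagrange_Ltilde//.
rewrite [Cl _ _ _]Cl_frm_v_lagr ?subr0; last exact: fr_dom_sub.
rewrite [X in _ - X]big1 ?subr0 => [|a _]; last first.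
  by rewrite sum_Rf_rshift// mulr0.
(* Only [A(p_b)] survives from the Kronecker delta, and it cancels [A(X_b^V L)], since [p_b] is by
   definition [X_b^V L]. *)
rewrite big_split/= (bigD1 b)//= eqxx mul1r big1 => [|a ab]; last first.
  by rewrite (inj_eq (@rshift_inj _ _)) (negPf ab) mul0r.
rewrite addr0 opprD addrA subrr sub0r => /eqP; rewrite oppr_eq0 => /eqP s0.
by apply: etrans s0; apply: eq_bigr => a _; rewrite !mxE.
Qed.

Lemma Ltilde_horizontal (A : E * E -> E * E) z al : regular_g F -> constr F z ->
  (forall i,
    apply_field A (Vl (frm F i) (Ltilde F)) z - Cl (frm F i) (Ltilde F) z = 0) ->
  apply_field A (Vl (frm_h F al) (lagr F)) z - Cl (frm_h F al) (lagr F) z =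
  \sum_(a < k) \sum_(be < m)
    Rf F (lshift k al) (lshift k be) (rshift m a) z.1
      * qvh F be z * momentum F a z.
Proof.
move=> hreg cz EL; have tg := Ltilde_tangent hreg cz EL.
have := EL (lshift k al); rewrite euler_lagrange_Ltilde//.
rewrite [X in _ - X - _]big1 ?subr0 => [|a _]; last first.
  by rewrite tg mulr0 addr0 eq_rlshift mul0r.
move=> /eqP; rewrite subr_eq0 => /eqP ->.
apply: eq_bigr => a _; rewrite mulr_sumr; apply: eq_bigr => be _.
by rewrite mulrC [Rf _ _ _ _ _ * _]mulrC.
Qed.

(** The difference of the two vectors is vertical, say [(0, e)]. Equal derivatives of the [v^a] make
    [e] horizontal; equal derivatives of the [X_beta^V L] then say that the row of coefficients of
    [e] is annihilated by the invertible matrix [g_alpha,beta]. *)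
Lemma second_order_unique (A B : E * E -> E * E) z : regular_D F ->
  constr F z -> (A z).1 = (B z).1 ->
  (forall a, apply_field A (qvv F a) z = apply_field B (qvv F a) z) ->
  (forall al, apply_field A (Vl (frm_h F al) (lagr F)) z =
              apply_field B (Vl (frm_h F al) (lagr F)) z) ->
  A z = B z.
Proof.
move=> hreg cz AB1 ABv ABh; have fz := constr_tangent_dom cz.
pose e := (A z).2 - (B z).2.
have eE : A z - B z = (0, e) by rewrite -(subrr (B z).1) -{1}AB1.
have DE (f : E * E -> R) : differentiable f z ->
    apply_field A f z = apply_field B f z -> 'D_(0, e) f z = 0.
  move=> df fAB; rewrite -eE (derive_dirB _ _ df).
  by apply/eqP; rewrite subr_eq0; apply/eqP.
have ev a : components F z.1 e 0 (rshift m a) = 0.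
  have := DE _ (qv_differentiable (rshift m a) fz) (ABv a).
  rewrite derive_qv//= big1 ?subr0// => i _.
  by rewrite derive0 scaler0.
pose d al := components F z.1 e 0 (lshift k al).
have eh : e = \sum_(al < m) d al *: frm_h F al z.1.
  rewrite -{1}(componentsK e fz) big_split_ord /= [X in _ + X]big1 ?addr0//.
  by move=> a _; rewrite ev scale0r.
suff d0 : \row_al d al = 0.
  have e0 : e = 0.
    rewrite eh big1// => al _.
    by have /rowP/(_ al) := d0; rewrite !mxE => ->; rewrite scale0r.
  by apply/eqP; rewrite -subr_eq0 eE e0.
rewrite -(mulmxK (hreg _ cz) (\row_al d al)).
suff -> : (\row_al d al) *m \matrix_(al < m, be < m)
    hess F (lshift k al) (lshift k be) z = 0 by rewrite mul0mx.
apply/rowP => be; rewrite !mxE.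
have dV := Vl_lagr_differentiable (lshift k be) fz.
have := DE _ dV (ABh be).
rewrite eh derive_dir_sum_snd// => s0.
by apply: etrans s0; apply: eq_bigr => al _; rewrite !mxE.
Qed.

End EL.

Theorem proposition6 (R : realType) (m k : nat)
    (G : lie_group R k) (Q : manifold R (m + k)) (S : chaplygin G Q)
    (F : adapted_frame S)
    (hregD : regular_D F) (hregg : regular_g F)
    (N : set ('rV[R]_(m + k) * 'rV[R]_(m + k)))
    (hNopen : open N) (hCN : constr F `<=` N) (hNTU : N `<=` tangent_dom F)
    (Gammat : 'rV[R]_(m + k) * 'rV[R]_(m + k) ->
              'rV[R]_(m + k) * 'rV[R]_(m + k))
    (hGammat : euler_lagrange_field F (Ltilde F) N Gammat)
    (Gamma : 'rV[R]_(m + k) * 'rV[R]_(m + k) ->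
             'rV[R]_(m + k) * 'rV[R]_(m + k))
    (hGamma : nonholonomic_field F Gamma) :
  [/\ (forall z, constr F z -> Gammat z = Gamma z) <->
      (forall (alpha : 'I_m) z, constr F z ->
         \sum_(a < k) \sum_(beta < m)
           Rf F (lshift k alpha) (lshift k beta) (rshift m a) z.1
           * qvh F beta z * momentum F a z = 0),
      (forall z, constr F z -> Gammat z = Gamma z) <->
        weakly_consistent F (momentum F)
    & (forall z, constr F z -> Gammat z = Gamma z) <->
        strongly_consistent F Gamma (momentum F)].
Proof.
have [_ sodet ELt] := hGammat; have [_ sode tgt EL] := hGamma.
have ELz z i (cz : constr F z) := ELt i z (hCN _ cz).
have hor z al (cz : constr F z) :=
  Ltilde_horizontal al hregg cz (fun i => ELz z i cz).
have main : (forall z, constr F z -> Gammat z = Gamma z) <->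
    (forall (alpha : 'I_m) z, constr F z ->
       \sum_(a < k) \sum_(beta < m)
         Rf F (lshift k alpha) (lshift k beta) (rshift m a) z.1
         * qvh F beta z * momentum F a z = 0).
  split=> [GG al z cz|cond z cz].
    (* By [hor] the sum is the left-hand side of the nonholonomic equation for [Gammat], which may
       be replaced by [Gamma]. *)
    by rewrite -hor// /apply_field GG//; exact: EL.
  apply: (second_order_unique hregD cz).
  - by rewrite sodet ?sode//; exact: hCN.
  - by move=> a; rewrite tgt//; apply: Ltilde_tangent => // i; exact: ELz.
  (* The terms [X_alpha^C L] do not involve the field, so it suffices to compare the full equations,
     both of which now have right-hand side zero. *)
  - move=> al; apply: (addIr (- Cl (frm_h F al) (lagr F) z)).
    exact: etrans (etrans (hor z al cz) (cond al z cz)) (esym (EL al z cz)).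
have weak : (forall z, constr F z -> Gammat z = Gamma z) <->
    weakly_consistent F (momentum F).
  apply: iff_trans main _.
  split=> cond al z cz; apply: etrans (cond al z cz);
    by do 2 (apply: eq_bigr => ? _); ring.
split=> //; apply: iff_trans weak _; split=> [wc|[]//]; split=> // a z cz.
(* The derivative of [p_a] along [Gamma] stands on both sides, [p_a] being [X_a^V L]; what remains
   is the vanishing of [X_a^C L] and of the curvature sum. *)
rewrite /multiplier [Cl _ _ _]Cl_frm_v_lagr; last exact: fr_dom_sub cz.1.
rewrite subr0 big1 ?addr0// => b _.
under eq_bigr do rewrite -mulrA [Rf _ _ _ _ _ * _]mulrC.
by rewrite -mulr_sumr sum_Rf_rshift ?mulr0//; exact: cz.1.
Qed.
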